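(* Let $p\in(-1,0)$ and let $j_{p,1}$ be the first positive zero of the Bessel function $J_p$. Then the Turán type inequality $$\mathcal{J}_{p+1}^2(x)-\frac{p+1}{p+2}\mathcal{J}_{p}(x)\mathcal{J}_{p+2}(x)>0$$ holds for all $x\in(-j_{p,1},j_{p,1})$.
   Context: For $q>-1$, $J_q(x)=\sum_{n\geq 0}\frac{(-1)^n (x/2)^{q+2n}}{n!\,\Gamma(q+n+1)}$ (for $x>0$) is the Bessel function of the first kind of order $q$. The normalized function $\mathcal{J}_q:\mathbb{R}\to\mathbb{R}$ is defined by $$\mathcal{J}_q(x)=2^q\Gamma(q+1)x^{-q}J_q(x)=\sum_{n\geq 0}\frac{(-1/4)^n}{(q+1)_n\, n!}x^{2n},$$ where $(q+1)_n=\Gamma(q+n+1)/\Gamma(q+1)$ is the Pochhammer symbol (the power series defines $\mathcal{J}_q$ for all real $x$, including $x=0$). *)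

(* Defs.v *)
From Stdlib Require Import Reals Factorial Lra.
From Coquelicot Require Import Coquelicot.
Open Scope R_scope.

(* Euler's integral of the second kind, improper at both ends; meaningful for
   x > 0, which covers all the arguments q + n + 1 with q > -1. *)
Definition Gamma (x : R) : R :=
  RInt_gen (fun t => Rpower t (x - 1) * exp (- t))
           (at_right 0) (Rbar_locally p_infty).

Definition pochhammer (a : R) (n : nat) : R := Gamma (a + INR n) / Gamma a.

(* Meaningful for x > 0 only, as [Rpower] is a junk value on x <= 0. *)
Definition BesselJ (q x : R) : R :=
  Series (fun n => (-1) ^ n * Rpower (x / 2) (q + 2 * INR n)
                   / (INR (fact n) * Gamma (q + INR n + 1))).

(* The power series, which makes sense for every real x; the closed form valid
   for x > 0 is [normBesselJ_BesselJ]. *)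
Definition normBesselJ (q x : R) : R :=
  Series (fun n => (-1 / 4) ^ n / (pochhammer (q + 1) n * INR (fact n))
                   * x ^ (2 * n)).

Definition is_first_positive_zero (f : R -> R) (j : R) : Prop :=
  0 < j /\ f j = 0 /\ (forall y, 0 < y < j -> f y <> 0).

Lemma normBesselJ_BesselJ (q x : R) : 0 < x ->
  normBesselJ q x = Rpower 2 q * Gamma (q + 1) * Rpower x (- q) * BesselJ q x.
Proof.
intros Hx; unfold normBesselJ, BesselJ.
rewrite <- Series_scal_l; apply Series_ext; intros n.
unfold pochhammer, Rdiv.
replace (q + 1 + INR n) with (q + INR n + 1) by ring.
rewrite Rpower_plus, !Rinv_mult, Rinv_inv.
replace (2 * INR n) with (INR (2 * n)) by (rewrite mult_INR; simpl; ring).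
rewrite Rpower_pow by lra.
rewrite <- (Rpower_mult_distr x (/ 2) q) by lra.
assert (E2 : Rpower 2 q * Rpower (/ 2) q = 1).
{ rewrite Rpower_mult_distr by lra.
  replace (2 * / 2) with 1 by field.
  unfold Rpower; rewrite ln_1, Rmult_0_r; apply exp_0. }
assert (Ex : Rpower x (- q) * Rpower x q = 1).
{ rewrite <- Rpower_plus.
  replace (- q + q) with 0 by ring; apply Rpower_O; exact Hx. }
assert (Ep : (-1 * / 4) ^ n * x ^ (2 * n) = (-1) ^ n * (x * / 2) ^ (2 * n)).
{ rewrite !pow_mult, <- !Rpow_mult_distr; f_equal; simpl; field. }
set (G := Gamma (q + 1)); set (H := / Gamma (q + INR n + 1)).
set (F := / INR (fact n)).
transitivity (((-1 * / 4) ^ n * x ^ (2 * n)) * H * G * F); [ring |].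
rewrite Ep.
transitivity ((Rpower 2 q * Rpower (/ 2) q) * (Rpower x (- q) * Rpower x q)
   * ((-1) ^ n * (x * / 2) ^ (2 * n) * H * G * F)); [| ring].
rewrite E2, Ex; ring.
Qed.

(* Main.v *)
Require Import Defs.
From Stdlib Require Import Reals Factorial Lra Lia.
From Coquelicot Require Import Coquelicot.
Open Scope R_scope.

(* With [a = p + 1], [y = x ^ 2] and [F_b] the power series in [y] of the normalized
   Bessel function of order [b - 1], the Turán expression
   [D = F_(a+1)^2 - a / (a + 1) F_a F_(a+2)] satisfies [y D' + (a + 1) D = F_(a+1)^2]
   (Lommel's integral of [t J^2] in differential form).  Hence [y ^ (a + 1) D] is
   nondecreasing for [y > 0]; since [D 0 = 1 / (a + 1) > 0], it is positive near [0],
   and so for all [y > 0].  The recurrences between the [F_b] rest on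
   [Gamma (x + 1) = x Gamma x], obtained from the improper integral. *)

(** * Improper integrals of positive functions over the positive half-line *)

Lemma ex_RInt_continuous_pos (f : R -> R) (u v : R) :
  (forall t, 0 < t -> continuous f t) -> 0 < u -> u <= v -> ex_RInt f u v.
Proof.
intros cf u0 uv; apply (ex_RInt_continuous (V := R_CompleteNormedModule)).
rewrite Rmin_left, Rmax_right by exact uv.
intros t [ut _]; apply cf; lra.
Qed.

(** The limit is the supremum of the integrals over compact intervals: positivity makes these
    integrals grow with the interval, and [M] bounds them. *)
Lemma is_RInt_gen_pos_bounded (f : R -> R) (M : R) :
  (forall t, 0 < t -> continuous f t) ->
  (forall t, 0 < t -> 0 < f t) ->
  (forall u v, 0 < u -> u <= v -> RInt f u v <= M) ->
  exists l, 0 < l /\ is_RInt_gen f (at_right 0) (Rbar_locally p_infty) l.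
Proof.
intros cf pf bf.
pose (E := fun s => exists u v, 0 < u /\ u <= v /\ s = RInt f u v).
destruct (completeness E) as [l [ub lub]].
{ exists M; intros s (u & v & u0 & uv & ->); exact (bf u v u0 uv). }
{ exists (RInt f 1 2); exists 1, 2; lra. }
exists l; split.
{ apply Rlt_le_trans with (RInt f 1 2).
  - apply RInt_gt_0; [lra | intros; apply pf; lra | intros; apply cf; lra].
  - apply ub; exists 1, 2; lra. }
intros P [eps HP].
assert (Hs : exists u v, 0 < u /\ u <= v /\ l - eps < RInt f u v).
{ apply Classical_Prop.NNPP; intros H.
  assert (l <= l - eps); [| destruct eps; simpl in *; lra].
  apply lub; intros s (u & v & u0 & uv & ->).
  apply Rnot_lt_le; intros Hlt; apply H; exists u, v; auto. }
destruct Hs as (u0 & v0 & pu & uv & Hl).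
(* Any interval containing [[u0, v0]] has an integral between that over [[u0, v0]] and [l], hence
   within [eps] of [l]. *)
apply (Filter_prod _ _ _ (fun u => 0 < u < u0) (fun v => v0 < v)).
- exists (mkposreal u0 pu); intros u Hu u_pos; split; [exact u_pos |].
  unfold ball, Hierarchy.ball in Hu; simpl in Hu.
  unfold AbsRing_ball, abs, minus, plus, opp in Hu; simpl in Hu.
  apply Rabs_def2 in Hu; lra.
- exists v0; auto.
- intros u v Hu Hv; simpl.
  exists (RInt f u v); split.
  { apply (RInt_correct (V := R_CompleteNormedModule)).
    apply ex_RInt_continuous_pos; auto; lra. }
  apply HP.
  assert (RInt f u v <= l) by (apply ub; exists u, v; lra).
  assert (RInt f u0 v0 <= RInt f u v).
  { rewrite <- (RInt_Chasles f u u0 v), <- (RInt_Chasles f u0 v0 v);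
      try (apply ex_RInt_continuous_pos; auto; lra).
    assert (0 <= RInt f u u0 /\ 0 <= RInt f v0 v); [| unfold plus; simpl; lra].
    split; (apply RInt_ge_0; [lra | apply ex_RInt_continuous_pos; auto; lra |]);
      intros t Ht; left; apply pf; lra. }
  unfold ball; simpl; unfold AbsRing_ball, abs, minus, plus, opp; simpl.
  apply Rabs_def1; destruct eps; simpl in *; lra.
Qed.

(** * Real powers: regularity and growth *)

Lemma is_derive_Rpower (x t : R) :
  0 < t -> is_derive (fun s => Rpower s x) t (x * Rpower t (x - 1)).
Proof. intros Ht; apply is_derive_Reals, derivable_pt_lim_power, Ht. Qed.

Lemma continuous_Rpower (x t : R) : 0 < t -> continuous (fun s => Rpower s x) t.
Proof.
intros Ht; apply (ex_derive_continuous (V := R_NormedModule)).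
eexists; apply is_derive_Rpower, Ht.
Qed.

Lemma Rpower_pos (t x : R) : 0 < Rpower t x.
Proof. apply exp_pos. Qed.

Lemma exp_le_compat (u v : R) : u <= v -> exp u <= exp v.
Proof. intros [H | ->]; [left; now apply exp_increasing | apply Rle_refl]. Qed.

(** The inequality [1 + s <= exp s] at [s = t / (2 * x)] gives [ln t <= ln (2 * x) + t / (2 * x)],
    to be multiplied by [x]. Only half of the exponent is spent, so that decay remains after
    multiplication by [exp (- t)]. *)
Lemma Rpower_le_exp_half (x t : R) :
  0 < x -> 0 < t -> Rpower t x <= Rpower (2 * x) x * exp (t / 2).
Proof.
intros Hx Ht; unfold Rpower; rewrite <- exp_plus.
assert (Hln : ln t <= ln (2 * x) + t / (2 * x)).
{ replace (t / (2 * x)) with (ln (exp (t / (2 * x)))) by apply ln_exp.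
  rewrite <- ln_mult by (try apply exp_pos; lra).
  apply ln_le; [exact Ht |].
  pose proof (exp_ineq1_le (t / (2 * x))) as H.
  apply Rmult_le_compat_l with (r := 2 * x) in H; [| lra].
  replace (2 * x * (1 + t / (2 * x))) with (2 * x + t) in H by (field; lra).
  lra. }
apply exp_le_compat.
apply Rmult_le_compat_l with (r := x) in Hln; [| lra].
replace (x * (ln (2 * x) + t / (2 * x))) with (x * ln (2 * x) + t / 2) in Hln
  by (field; lra).
exact Hln.
Qed.

(** * Euler's integral: convergence, positivity and the functional equation *)

Definition Gamma_integrand (x t : R) : R := Rpower t (x - 1) * exp (- t).

Lemma continuous_exp_opp (t : R) : continuous (fun s => exp (- s)) t.
Proof.
apply (ex_derive_continuous (V := R_NormedModule)); auto_derive; auto.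
Qed.

Lemma continuous_Gamma_integrand (x t : R) :
  0 < t -> continuous (Gamma_integrand x) t.
Proof.
intros Ht; apply (continuous_mult (K := R_AbsRing)).
- apply continuous_Rpower, Ht.
- apply continuous_exp_opp.
Qed.

(** Integration by parts in pointwise form; it serves both the bound on the integral and the
    functional equation. *)
Lemma is_derive_Gamma_integrand (x t : R) : 0 < t ->
  is_derive (Gamma_integrand (x + 1)) t
    (x * Gamma_integrand x t - Gamma_integrand (x + 1) t).
Proof.
intros Ht; unfold Gamma_integrand.
replace (x + 1 - 1) with x by ring.
evar_last.
- apply (is_derive_mult (fun s => Rpower s x) (fun s => exp (- s))).
  + apply is_derive_Rpower, Ht.
  + auto_derive; [exact I | reflexivity].
  + intros; apply Rmult_comm.
- unfold plus, mult; simpl; ring.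
Qed.

Lemma Gamma_integrand_pos (x t : R) : 0 < Gamma_integrand x t.
Proof. apply Rmult_lt_0_compat; [apply Rpower_pos | apply exp_pos]. Qed.

Lemma Gamma_integrand_S_le (x t : R) : 0 < x -> 0 < t ->
  Gamma_integrand (x + 1) t <= Rpower (2 * x) x * exp (- t / 2).
Proof.
intros Hx Ht; unfold Gamma_integrand.
replace (x + 1 - 1) with x by ring.
replace (exp (- t / 2)) with (exp (t / 2) * exp (- t))
  by (rewrite <- exp_plus; f_equal; field).
rewrite <- Rmult_assoc; apply Rmult_le_compat_r; [left; apply exp_pos |].
now apply Rpower_le_exp_half.
Qed.

(* Integrating [t ^ (x - 1) e ^ - t] by parts leaves [t ^ x e ^ - t / x], which is
   dominated by a multiple of [e ^ (- t / 2)]. *)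
Lemma RInt_Gamma_integrand_le (x u v : R) : 0 < x -> 0 < u -> u <= v ->
  RInt (Gamma_integrand x) u v <= 2 * Rpower (2 * x) x / x.
Proof.
intros Hx Hu Huv.
set (C := Rpower (2 * x) x).
assert (HC : 0 < C) by apply Rpower_pos.
(* This is [Gamma_integrand x t] plus the nonnegative slack [(C * exp (- t / 2) - Gamma_integrand (x
   + 1) t) / x], chosen so that the explicit [H] is a primitive. *)
pose (dH := fun t => / x * (x * Gamma_integrand x t - Gamma_integrand (x + 1) t
                            + C * exp (- t / 2))).
pose (H := fun t => / x * (Gamma_integrand (x + 1) t - 2 * C * exp (- t / 2))).
assert (HI : is_RInt dH u v (H v - H u)).
{ apply (is_RInt_derive H dH); rewrite Rmin_left, Rmax_right by exact Huv;
    intros t Ht.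
  - apply (is_derive_scal (fun t => Gamma_integrand (x + 1) t
                                    - 2 * C * exp (- t / 2))).
    evar_last.
    + apply (is_derive_minus (Gamma_integrand (x + 1))
               (fun t => 2 * C * exp (- t / 2))).
      * apply is_derive_Gamma_integrand; lra.
      * auto_derive; [exact I | reflexivity].
    + unfold minus, plus, opp; simpl; unfold Rdiv; field.
  - apply (continuous_scal_r (/ x) (fun t => x * Gamma_integrand x t
             - Gamma_integrand (x + 1) t + C * exp (- t / 2))).
    apply (continuous_plus (V := R_NormedModule)).
    + apply (continuous_minus (V := R_NormedModule)).
      * apply (continuous_scal_r x (Gamma_integrand x)).
        apply continuous_Gamma_integrand; lra.
      * apply continuous_Gamma_integrand; lra.
    + apply (ex_derive_continuous (V := R_NormedModule)); auto_derive; auto. }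
apply Rle_trans with (H v - H u).
- rewrite <- (is_RInt_unique _ _ _ _ HI).
  apply RInt_le; [exact Huv | | eexists; apply HI |].
  + apply ex_RInt_continuous_pos; auto; apply continuous_Gamma_integrand.
  + intros t Ht; unfold dH.
    pose proof (Gamma_integrand_S_le x t Hx ltac:(lra)) as B; fold C in B.
    apply Rmult_le_reg_l with x; [exact Hx |].
    rewrite <- Rmult_assoc, Rinv_r by lra; lra.
- unfold H.
  pose proof (Gamma_integrand_S_le x v Hx ltac:(lra)) as B; fold C in B.
  pose proof (Gamma_integrand_pos (x + 1) u) as B'.
  assert (0 < C * exp (- v / 2)) by (apply Rmult_lt_0_compat; auto; apply exp_pos).
  assert (C * exp (- u / 2) <= C * 1).
  { apply Rmult_le_compat_l; [lra |].
    rewrite <- exp_0; apply exp_le_compat; lra. }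
  apply Rmult_le_reg_l with x; [exact Hx |].
  unfold Rdiv; rewrite Rmult_minus_distr_l.
  rewrite <- !(Rmult_assoc x (/ x)), Rinv_r by lra.
  replace (x * (2 * C * / x)) with (2 * C) by (field; lra); lra.
Qed.

(** [RInt_gen] is total, so the value of [Gamma] carries information only once convergence is known;
    uniqueness of the limit then identifies it. *)
Lemma is_RInt_gen_Gamma (x : R) : 0 < x ->
  0 < Gamma x /\
  is_RInt_gen (Gamma_integrand x) (at_right 0) (Rbar_locally p_infty) (Gamma x).
Proof.
intros Hx.
destruct (is_RInt_gen_pos_bounded (Gamma_integrand x)
            (2 * Rpower (2 * x) x / x)) as (l & Hl & HI).
- apply continuous_Gamma_integrand.
- intros; apply Gamma_integrand_pos.
- intros; now apply RInt_Gamma_integrand_le.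
- replace (Gamma x) with l; [auto |].
  symmetry; exact (is_RInt_gen_unique _ _ HI).
Qed.

Lemma Gamma_pos (x : R) : 0 < x -> 0 < Gamma x.
Proof. apply is_RInt_gen_Gamma. Qed.

Lemma Rbar_mult_pos_m_infty (x : R) : 0 < x -> Rbar_mult x m_infty = m_infty.
Proof.
intros Hx; simpl; destruct Rle_dec as [H |]; [| lra].
destruct Rle_lt_or_eq_dec; [reflexivity | lra].
Qed.

(** The boundary term at 0 vanishes because [x * ln t] tends to minus infinity. *)
Lemma filterlim_Gamma_integrand_0 (x : R) : 0 < x ->
  filterlim (Gamma_integrand (x + 1)) (at_right 0) (locally 0).
Proof.
intros Hx.
apply filterlim_ext with (fun t => exp (x * ln t) * exp (- t)).
{ intros t; unfold Gamma_integrand, Rpower; now replace (x + 1 - 1) with x by ring. }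
replace 0 with (0 * exp (- 0)) at 2 by ring.
apply (filterlim_comp_2 (G := locally 0) (H := locally (exp (- 0))));
  [| | apply (filterlim_mult (K := R_AbsRing))].
- apply filterlim_comp with (Rbar_locally m_infty); [| apply is_lim_exp_m].
  apply filterlim_comp with (Rbar_locally m_infty); [apply is_lim_ln_0 |].
  pose proof (filterlim_Rbar_mult_l x m_infty) as L.
  now rewrite Rbar_mult_pos_m_infty in L.
- apply (filterlim_filter_le_1 (F := locally 0)).
  + intros P HP; now apply filter_le_within.
  + apply continuous_exp_opp.
Qed.

Lemma filterlim_Gamma_integrand_p_infty (x : R) : 0 < x ->
  filterlim (Gamma_integrand (x + 1)) (Rbar_locally p_infty) (locally 0).
Proof.
intros Hx.
assert (L : is_lim (fun t => Rpower (2 * x) x * exp (/ 2 * - t)) p_infty 0).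
{ replace (Finite 0) with (Rbar_mult (Rpower (2 * x) x) 0)
    by (simpl; f_equal; ring).
  apply is_lim_scal_l.
  apply (is_lim_comp exp _ p_infty 0 m_infty).
  - apply is_lim_exp_m.
  - rewrite <- (Rbar_mult_pos_m_infty (/ 2)) by lra.
    apply is_lim_scal_l, (is_lim_opp (fun t => t) p_infty p_infty), is_lim_id.
  - exists 0; discriminate. }
apply (is_lim_le_le_loc (fun _ => 0) (fun t => Rpower (2 * x) x * exp (/ 2 * - t))
         _ p_infty 0); [| apply is_lim_const | exact L].
exists 0; intros t Ht; split; [left; apply Gamma_integrand_pos |].
replace (/ 2 * - t) with (- t / 2) by field.
now apply Gamma_integrand_S_le.
Qed.

(** The derivative of [Gamma_integrand (x + 1)] integrates to [x * Gamma x - Gamma (x + 1)] by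
    linearity, and to 0 by the vanishing boundary terms. *)
Lemma Gamma_S (x : R) : 0 < x -> Gamma (x + 1) = x * Gamma x.
Proof.
intros Hx.
destruct (is_RInt_gen_Gamma x Hx) as [_ I0].
destruct (is_RInt_gen_Gamma (x + 1)) as [_ I1]; [lra |].
(* Eventually both endpoints are positive, so facts known only for [0 < t] hold on the whole
   interval. *)
assert (Epos : forall P : R -> Prop, (forall t, 0 < t -> P t) ->
  filter_prod (at_right 0) (Rbar_locally p_infty) (fun ab =>
    forall t, Rmin (fst ab) (snd ab) <= t <= Rmax (fst ab) (snd ab) -> P t)).
{ intros P HP.
  apply (Filter_prod _ _ _ (fun u => 0 < u) (fun v => 0 < v)).
  - exists (mkposreal 1 Rlt_0_1); auto.
  - exists 0; auto.
  - intros u v Hu Hv t [Ht _]; apply HP; simpl in Ht.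
    apply Rlt_le_trans with (2 := Ht); now apply Rmin_pos. }
assert (Dv : forall t, 0 < t -> Derive (Gamma_integrand (x + 1)) t
              = x * Gamma_integrand x t - Gamma_integrand (x + 1) t).
{ intros t Ht; apply is_derive_unique, is_derive_Gamma_integrand, Ht. }
assert (ID := is_RInt_gen_minus _ _ _ _ (is_RInt_gen_scal _ x _ I0) I1).
assert (IP : is_RInt_gen (Derive (Gamma_integrand (x + 1))) (at_right 0)
               (Rbar_locally p_infty) (0 - 0)).
{ apply is_RInt_gen_Derive.
  - apply Epos; intros t Ht; eexists; apply is_derive_Gamma_integrand, Ht.
  - apply Epos; intros t Ht.
    apply continuous_ext_loc with
      (fun t => x * Gamma_integrand x t - Gamma_integrand (x + 1) t).
    (* The radius [t] keeps the ball inside the positive half-line, where [Dv] applies. *)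
    + exists (mkposreal t Ht); intros s Hs; symmetry; apply Dv.
      unfold ball in Hs; simpl in Hs.
      unfold AbsRing_ball, abs, minus, plus, opp in Hs; simpl in Hs.
      apply Rabs_def2 in Hs; lra.
    + apply (continuous_minus (V := R_NormedModule)).
      * apply (continuous_scal_r x (Gamma_integrand x)).
        apply continuous_Gamma_integrand; lra.
      * apply continuous_Gamma_integrand; lra.
  - now apply filterlim_Gamma_integrand_0.
  - now apply filterlim_Gamma_integrand_p_infty. }
apply is_RInt_gen_ext with (g := fun t => minus (scal x (Gamma_integrand x t))
                                   (Gamma_integrand (x + 1) t)) in IP.
- apply (is_RInt_gen_unique (V := R_CompleteNormedModule)) in ID.
  apply (is_RInt_gen_unique (V := R_CompleteNormedModule)) in IP.
  assert (E := eq_trans (eq_sym ID) IP).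
  unfold minus, scal, plus, opp in E; simpl in E.
  unfold mult in E; simpl in E; lra.
- apply filter_imp with (2 := Epos _ Dv).
  intros ab H t Ht; apply H; lra.
Qed.

(** * Pochhammer symbols and the coefficients of the series *)

Lemma pochhammer_0 (a : R) : 0 < a -> pochhammer a 0 = 1.
Proof.
intros Ha; unfold pochhammer; simpl INR; rewrite Rplus_0_r.
apply Rinv_r, Rgt_not_eq, Gamma_pos, Ha.
Qed.

Lemma pochhammer_pos (a : R) (n : nat) : 0 < a -> 0 < pochhammer a n.
Proof.
intros Ha; pose proof (pos_INR n).
apply Rdiv_lt_0_compat; apply Gamma_pos; lra.
Qed.

Lemma pochhammer_S_r (a : R) (n : nat) : 0 < a ->
  pochhammer a (S n) = (a + INR n) * pochhammer a n.
Proof.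
intros Ha; pose proof (pos_INR n); unfold pochhammer; rewrite S_INR.
rewrite <- Rplus_assoc, Gamma_S by lra; unfold Rdiv; ring.
Qed.

(** Peeling off the first factor shifts the parameter; this is why differentiating the series raises
    the order. *)
Lemma pochhammer_S_l (a : R) (n : nat) : 0 < a ->
  pochhammer a (S n) = a * pochhammer (a + 1) n.
Proof.
intros Ha; unfold pochhammer; rewrite S_INR, (Gamma_S a) by lra.
replace (a + 1 + INR n) with (a + (INR n + 1)) by ring.
field; split; [apply Rgt_not_eq, Gamma_pos | apply Rgt_not_eq]; lra.
Qed.

(** Coefficients in the variable [x ^ 2], indexed by [a = q + 1] so that [q > -1] becomes
    [0 < a]. *)
Definition bessel_coeff (a : R) (n : nat) : R :=
  (-1 / 4) ^ n / (pochhammer a n * INR (fact n)).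

Lemma normBesselJ_PSeries (q x : R) :
  normBesselJ q x = PSeries (bessel_coeff (q + 1)) (x ^ 2).
Proof. apply Series_ext; intros n; now rewrite pow_mult. Qed.

Lemma bessel_coeff_S (a : R) (n : nat) : 0 < a ->
  bessel_coeff a (S n) = - / 4 * / ((a + INR n) * INR (S n)) * bessel_coeff a n.
Proof.
intros Ha; unfold bessel_coeff.
rewrite pochhammer_S_r, fact_simpl, mult_INR by lra; simpl pow.
pose proof (pochhammer_pos a n Ha); pose proof (INR_fact_neq_0 n).
pose proof (pos_INR n); pose proof (lt_0_INR (S n) ltac:(lia)).
field; repeat split; lra.
Qed.

Lemma CV_radius_bessel_coeff (a : R) :
  0 < a -> CV_radius (bessel_coeff a) = p_infty.
Proof.
intros Ha.
assert (NZ : forall n, bessel_coeff a n <> 0).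
{ intros n; unfold bessel_coeff, Rdiv.
  apply Rmult_integral_contrapositive_currified.
  - apply pow_nonzero; lra.
  - apply Rinv_neq_0_compat, Rgt_not_eq, Rmult_lt_0_compat;
      [now apply pochhammer_pos | apply INR_fact_lt_0]. }
apply CV_radius_infinite_DAlembert; [exact NZ |].
(* A majorant of the ratio of consecutive coefficients, from [a <= a + INR n]. *)
assert (L : is_lim_seq (fun n => / a * / INR (S n)) 0).
{ replace (Finite 0) with (Rbar_mult (/ a) 0) by (simpl; f_equal; ring).
  apply is_lim_seq_scal_l.
  apply (is_lim_seq_incr_1 (fun n => / INR n)).
  apply (is_lim_seq_inv _ p_infty); [apply is_lim_seq_INR | discriminate]. }
apply (is_lim_seq_le_le (fun _ => 0)) with (3 := L); [| apply is_lim_seq_const].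
intros n; split; [apply Rabs_pos |].
rewrite bessel_coeff_S by exact Ha.
pose proof (pos_INR n); pose proof (lt_0_INR (S n) ltac:(lia)).
replace (- / 4 * / ((a + INR n) * INR (S n)) * bessel_coeff a n / bessel_coeff a n)
  with (- (/ 4 * / (a + INR n) * / INR (S n))).
2:{ field; repeat split; try apply NZ; lra. }
assert (0 < / (a + INR n)) by (apply Rinv_0_lt_compat; lra).
assert (0 < / INR (S n)) by (apply Rinv_0_lt_compat; lra).
assert (/ (a + INR n) <= / a) by (apply Rinv_le_contravar; lra).
rewrite Rabs_Ropp, Rabs_pos_eq.
- apply Rmult_le_compat_r; lra.
- apply Rmult_le_pos; lra.
Qed.

(** * The entire series in [y], its derivative and the contiguous relation *)

Definition bessel_series (a y : R) : R := PSeries (bessel_coeff a) y.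

Lemma bessel_series_0 (a : R) : 0 < a -> bessel_series a 0 = 1.
Proof.
intros Ha; unfold bessel_series; rewrite PSeries_0; unfold bessel_coeff.
rewrite pochhammer_0 by exact Ha; simpl; field.
Qed.

Lemma is_derive_bessel_series (a y : R) : 0 < a ->
  is_derive (bessel_series a) y (- / (4 * a) * bessel_series (a + 1) y).
Proof.
intros Ha; evar_last.
- apply is_derive_PSeries; rewrite CV_radius_bessel_coeff by exact Ha; exact I.
- unfold bessel_series; rewrite <- PSeries_scal.
  apply PSeries_ext; intros n; unfold PS_derive, PS_scal, scal; simpl.
  unfold mult; simpl; unfold bessel_coeff.
  rewrite pochhammer_S_l, fact_simpl, mult_INR by lra; simpl pow.
  pose proof (pochhammer_pos (a + 1) n ltac:(lra)); pose proof (INR_fact_neq_0 n).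
  change (match n with 0%nat => 1 | S _ => INR n + 1 end) with (INR (S n)).
  pose proof (lt_0_INR (S n) ltac:(lia)).
  field; repeat split; lra.
Qed.

Lemma ex_pseries_bessel (a y : R) : 0 < a -> ex_pseries (bessel_coeff a) y.
Proof.
intros Ha; apply CV_radius_inside.
rewrite CV_radius_bessel_coeff by exact Ha; exact I.
Qed.

(* The contiguous relation [y F' = a (F_a - F_(a+1))] for [F = F_(a+1)], with the
   derivative replaced by its value. *)
Lemma bessel_series_contiguous (a y : R) : 0 < a ->
  y * (- / (4 * (a + 1)) * bessel_series (a + 2) y)
  = a * (bessel_series a y - bessel_series (a + 1) y).
Proof.
intros Ha; unfold bessel_series.
transitivity (PSeries (PS_incr_1 (PS_scal (- / (4 * (a + 1)))
                                    (bessel_coeff (a + 2)))) y).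
{ rewrite PSeries_incr_1, PSeries_scal; reflexivity. }
rewrite <- PSeries_minus by (apply ex_pseries_bessel; lra).
rewrite <- PSeries_scal.
(* The factor [y] shifts indices by one: the constant terms cancel on the right, and index [S n]
   there meets index [n] on the left. *)
apply PSeries_ext; intros [|n];
  unfold PS_incr_1, PS_scal, PS_minus, PS_plus, PS_opp, plus, opp, scal; simpl;
  unfold mult, zero; simpl; unfold bessel_coeff.
- rewrite !pochhammer_0 by lra; simpl; field.
- rewrite (pochhammer_S_l a), (pochhammer_S_r (a + 1)) by lra.
  (* Both sides are [pochhammer (a + 1) (S n)]; this lets every symbol be written through
     [pochhammer (a + 2) n]. *)
  assert (E : (a + 1 + INR n) * pochhammer (a + 1) n
              = (a + 1) * pochhammer (a + 2) n).
  { rewrite <- pochhammer_S_r, pochhammer_S_l by lra.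
    now replace (a + 1 + 1) with (a + 2) by ring. }
  rewrite E.
  assert (E' : pochhammer (a + 1) n
               = (a + 1) * pochhammer (a + 2) n / (a + 1 + INR n)).
  { rewrite <- E; pose proof (pos_INR n); field; lra. }
  rewrite E'.
  change (fact n + n * fact n)%nat with (fact (S n)).
  rewrite fact_simpl, mult_INR, S_INR; simpl pow.
  pose proof (pochhammer_pos (a + 2) n ltac:(lra)).
  pose proof (INR_fact_neq_0 n); pose proof (pos_INR n).
  field; repeat split; lra.
Qed.

(** * The Turán expression: differential equation and positivity *)

Definition bessel_turan (a y : R) : R :=
  bessel_series (a + 1) y ^ 2
  - a / (a + 1) * bessel_series a y * bessel_series (a + 2) y.

Lemma is_derive_bessel_turan (a y : R) : 0 < a ->
  exists d, is_derive (bessel_turan a) y d /\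
    y * d + (a + 1) * bessel_turan a y = bessel_series (a + 1) y ^ 2.
Proof.
intros Ha.
pose proof (is_derive_bessel_series a y Ha) as D0.
pose proof (is_derive_bessel_series (a + 1) y ltac:(lra)) as D1.
pose proof (is_derive_bessel_series (a + 2) y ltac:(lra)) as D2.
pose proof (bessel_series_contiguous a y Ha) as C1.
pose proof (bessel_series_contiguous (a + 1) y ltac:(lra)) as C2.
replace (a + 1 + 1) with (a + 2) in * by ring.
replace (a + 1 + 2) with (a + 2 + 1) in * by ring.
eexists; split.
- unfold bessel_turan; auto_derive.
  + repeat split; eexists; eassumption.
  + replace (Derive (fun x => bessel_series a x) y) with
      (- / (4 * a) * bessel_series (a + 1) y) by (symmetry; apply is_derive_unique, D0).
    replace (Derive (fun x => bessel_series (a + 1) x) y) with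
      (- / (4 * (a + 1)) * bessel_series (a + 2) y)
      by (symmetry; apply is_derive_unique, D1).
    replace (Derive (fun x => bessel_series (a + 2) x) y) with
      (- / (4 * (a + 2)) * bessel_series (a + 2 + 1) y)
      by (symmetry; apply is_derive_unique, D2).
    reflexivity.
- unfold bessel_turan.
  set (F0 := bessel_series a y) in *; set (F1 := bessel_series (a + 1) y) in *.
  set (F2 := bessel_series (a + 2) y) in *.
  set (F3 := bessel_series (a + 2 + 1) y) in *.
  (* The derivatives are grouped with [y] to match [C1] and [C2]. The term in [F0' * F2] becomes
     [- F1 * (y * F1')], since [F0'] and [F1'] are multiples of [F1] and [F2]. *)
  transitivity (2 * F1 * (y * (- / (4 * (a + 1)) * F2))
    - F1 * (y * (- / (4 * (a + 1)) * F2))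
    - a / (a + 1) * F0 * (y * (- / (4 * (a + 2)) * F3))
    + (a + 1) * (F1 ^ 2 - a / (a + 1) * F0 * F2)).
  + field; lra.
  + rewrite C1, C2; field; lra.
Qed.

Lemma bessel_turan_pos (a y : R) : 0 < a -> 0 <= y -> 0 < bessel_turan a y.
Proof.
intros Ha Hy.
assert (T0 : 0 < bessel_turan a 0).
{ unfold bessel_turan; rewrite !bessel_series_0 by lra.
  replace (1 ^ 2 - a / (a + 1) * 1 * 1) with (/ (a + 1)) by (field; lra).
  apply Rinv_0_lt_compat; lra. }
destruct Hy as [Hy | <-]; [| exact T0].
(* The comparison starts at some [e > 0], as [Rpower] takes a default value at 0. *)
assert (Ey : exists e, 0 < e < y /\ 0 < bessel_turan a e).
{ assert (Cont : continuous (bessel_turan a) 0).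
  { destruct (is_derive_bessel_turan a 0 Ha) as (d & Hd & _).
    apply (ex_derive_continuous (V := R_NormedModule)); now exists d. }
  destruct (Cont _ (open_gt 0 _ T0)) as [eps Heps].
  pose proof (cond_pos eps).
  exists (Rmin (eps / 2) (y / 2)).
  assert (0 < Rmin (eps / 2) (y / 2)) by (apply Rmin_pos; lra).
  pose proof (Rmin_l (eps / 2) (y / 2)); pose proof (Rmin_r (eps / 2) (y / 2)).
  split; [lra |]; apply Heps.
  unfold ball; simpl; unfold AbsRing_ball, abs, minus, plus, opp; simpl.
  apply Rabs_def1; lra. }
destruct Ey as (e & He & Te).
pose (h := fun t => Rpower t (a + 1) * bessel_turan a t).
pose (dh := fun t => Rpower t a * bessel_series (a + 1) t ^ 2).
assert (Dh : forall t, 0 < t -> is_derive h t (dh t)).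
{ intros t Ht; destruct (is_derive_bessel_turan a t Ha) as (d & Hd & E).
  evar_last.
  - apply (is_derive_mult (fun t => Rpower t (a + 1)) (bessel_turan a)).
    + apply is_derive_Rpower, Ht.
    + exact Hd.
    + intros; apply Rmult_comm.
  - unfold dh, plus, mult; simpl.
    replace (a + 1 - 1) with a by ring.
    rewrite Rpower_plus, Rpower_1 by exact Ht.
    simpl in E; rewrite <- E; ring. }
(* Since [dh] is a positive power times a square, this yields [h y >= h e > 0]. *)
destruct (MVT_gen h e y dh) as (c & Hc & Eh).
- intros t Ht; apply Dh; rewrite Rmin_left in Ht; lra.
- intros t Ht; rewrite Rmin_left in Ht by lra.
  apply continuity_pt_filterlim.
  apply (ex_derive_continuous (V := R_NormedModule)).
  exists (dh t); apply Dh; lra.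
- assert (0 < h e) by (apply Rmult_lt_0_compat; [apply Rpower_pos | exact Te]).
  assert (0 <= dh c * (y - e)).
  { apply Rmult_le_pos; [| lra].
    apply Rmult_le_pos; [left; apply Rpower_pos | apply pow2_ge_0]. }
  apply Rmult_lt_reg_l with (Rpower y (a + 1)); [apply Rpower_pos |].
  fold (h y); lra.
Qed.

Theorem mainTheorem4 (p j : R) (hp : -1 < p < 0)
    (hj : is_first_positive_zero (BesselJ p) j) (x : R) (hx : - j < x < j) :
  (normBesselJ (p + 1) x) ^ 2
    - (p + 1) / (p + 2) * normBesselJ p x * normBesselJ (p + 2) x > 0.
Proof.
pose proof (bessel_turan_pos (p + 1) (x ^ 2) ltac:(lra) (pow2_ge_0 x)) as T.
rewrite !normBesselJ_PSeries.
unfold bessel_turan, bessel_series in T.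
(* Order [q] has parameter [q + 1]. This rewrite comes first because [p + 2 + 1] contains
   [p + 2]. *)
replace (p + 2 + 1) with (p + 1 + 2) by ring.
replace (p + 2) with (p + 1 + 1) by ring.
exact T.
Qed.
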